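(* Let $\sigma_1<\sigma_2<\cdots<\sigma_K$ be real numbers, let $f:\mathbb{R}\to\mathbb{R}$ be continuous, strictly convex, with a minimum at $0$, and let $c_k(s)=f(s-\sigma_k)$ for $k\in\mathcal{K}=\{1,\dots,K\}$. Let $\mu>0$, $Q_k>0$ ($k\in\mathcal K$), $Q=\sum_{k\in\mathcal K}Q_k$, $T=Q/\mu$, and let $\hat{\mathcal S}=[s_0,s_0+T]$ be the (given) equilibrium rush period. Consider the problem $$\min_{\mathbf{x}\ge 0}\ \sum_{k\in\mathcal K}\int_{\hat{\mathcal S}}c_k(s)x_k(s)\,\mathrm{d}s\quad\text{subject to}\quad \sum_{k\in\mathcal K}x_k(s)=\mu\ \ \forall s\in\hat{\mathcal S},\qquad \int_{\hat{\mathcal S}}x_k(s)\,\mathrm{d}s=Q_k\ \ \forall k\in\mathcal K .$$ Then this problem has a unique solution $\mathbf{x}^*$, and its cumulative form $F^*(\kappa,s)=\sum_{k'\le\kappa}\int_{s_0}^{s}x^*_{k'}(s')\,\mathrm{d}s'$ is given by $$F^*(\kappa,s)=\min\Big\{\sum_{k'\le\kappa}Q_{k'},\ \mu\,(s-s_0)\Big\}\qquad \forall\kappa\in[1,K],\ \forall s\in\hat{\mathcal S}.$$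
   Context: The departure-time choice equilibrium at a single bottleneck of capacity $\mu$ with $K$ user groups of masses $Q_k$, schedule delay costs $c_k(s)$ and preferred departure times $\sigma_k$ is represented by a linear program; when the rush period (the set of departure times at which the bottleneck is used at capacity) is a single interval $\hat{\mathcal S}=[s_0,s_0+T]$, the program restricted to that period is the one displayed in the claim. The unknowns $x_k$ are nonnegative measurable functions on $\hat{\mathcal S}$ (departure flow rates of group $k$); constraints on $s$ are understood for almost every $s$, and flows equal almost everywhere are identified. The index $k'$ in the sums ranges over integers in $\{1,\dots,K\}$, while $\kappa$ is a real number. *)

(* Defs.v *)
From HB Require Import structures.
From mathcomp Require Import all_boot all_order all_algebra.
From mathcomp Require Import all_classical all_reals all_analysis.
Set Implicit Arguments.
Unset Strict Implicit.
Unset Printing Implicit Defensive.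
Import Order.TTheory GRing.Theory Num.Theory.
Import numFieldNormedType.Exports.
Local Open Scope classical_set_scope.
Local Open Scope ring_scope.

Definition strictly_convex (R : realType) (f : R -> R) : Prop :=
  forall (x y t : R), x != y -> 0 < t -> t < 1 ->
    f (t * x + (1 - t) * y) < t * f x + (1 - t) * f y.

Definition rush_period (R : realType) (K : nat) (mu : R) (Q : 'I_K -> R)
    (s0 : R) : set R :=
  `[s0, s0 + (\sum_(k < K) Q k) / mu]%classic.

Definition schedule_cost (R : realType) (K : nat) (f : R -> R)
    (sigma : 'I_K -> R) (k : 'I_K) (s : R) : R :=
  f (s - sigma k).

Definition feasible (R : realType) (K : nat) (mu : R) (Q : 'I_K -> R)
    (S : set R) (x : 'I_K -> R -> R) : Prop :=
  [/\ forall k, measurable_fun S (x k),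
      forall k, {ae lebesgue_measure, forall s, S s -> 0 <= x k s},
      {ae lebesgue_measure, forall s, S s -> \sum_(k < K) x k s = mu} &
      forall k,
        (\int[lebesgue_measure]_(s in S) (x k s)%:E)%E = (Q k)%:E].

(* On feasible flows and for continuous costs all the integrals are finite,
   so no indeterminate sum of infinities arises. *)
Definition total_cost (R : realType) (K : nat) (c : 'I_K -> R -> R)
    (S : set R) (x : 'I_K -> R -> R) : \bar R :=
  (\sum_(k < K) \int[lebesgue_measure]_(s in S) (c k s * x k s)%:E)%E.

Definition optimal (R : realType) (K : nat) (c : 'I_K -> R -> R) (mu : R)
    (Q : 'I_K -> R) (S : set R) (x : 'I_K -> R -> R) : Prop :=
  feasible mu Q S x /\
  forall y, feasible mu Q S y -> (total_cost c S x <= total_cost c S y)%E.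

Definition flow_eq (R : realType) (K : nat) (S : set R)
    (x y : 'I_K -> R -> R) : Prop :=
  forall k, {ae lebesgue_measure, forall s, S s -> x k s = y k s}.

(* The group numbered k in {1, ..., K} is the ordinal of value k - 1;
   hence k.+1 in the two sums below. *)
Definition cumulative_flow (R : realType) (K : nat) (s0 : R)
    (x : 'I_K -> R -> R) (kappa s : R) : \bar R :=
  (\sum_(k < K | (k.+1%:R <= kappa)%R)
     \int[lebesgue_measure]_(t in `[s0, s]%classic) (x k t)%:E)%E.

Definition cumulative_mass (R : realType) (K : nat) (Q : 'I_K -> R)
    (kappa : R) : R :=
  \sum_(k < K | k.+1%:R <= kappa) Q k.

(* Main.v *)
(* Complementary slackness.  By strict convexity c_k - c_l is strictly
   increasing in s for k < l, so prices v_k on the mass constraints can be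
   chosen with c_k - v_k and c_(k+1) - v_(k+1) crossing exactly at the time
   where the sorted flow switches from group k to group k+1.  Then, away from
   these times, the group served by the sorted flow is the only minimizer of
   c_k(s) - v_k.  Since the prices shift the cost of all feasible flows by the
   same constant, any mass assigned to another group strictly raises the
   cost. *)
Require Import Defs.
From HB Require Import structures.
From mathcomp Require Import all_boot all_order all_algebra.
From mathcomp Require Import all_classical all_reals all_analysis.
From mathcomp Require Import measurable_realfun ring lra.
Set Implicit Arguments.
Unset Strict Implicit.
Unset Printing Implicit Defensive.
Import Order.TTheory GRing.Theory Num.Theory.
Import numFieldNormedType.Exports.
Local Open Scope classical_set_scope.
Local Open Scope ring_scope.

(** * Strict convexity and separating prices *)

(** Both [u + h] and [u'] lie strictly between [u] and [u' + h], with convex weights swapped; adding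
    the two convexity inequalities gives the claim. *)
Lemma strictly_convex_increment (R : realType) (f : R -> R) (u u' h : R) :
  strictly_convex f -> u < u' -> 0 < h -> f (u + h) - f u < f (u' + h) - f u'.
Proof.
move=> f_conv uu' h0; pose L := u' + h - u; have L0 : 0 < L by rewrite /L; lra.
have neq : u != u' + h by rewrite lt_eqF//; lra.
have d0 : 0 < u' - u by rewrite subr_gt0.
have t0 : 0 < (u' - u) / L by rewrite divr_gt0.
have t1 : (u' - u) / L < 1 by rewrite ltr_pdivrMr// /L; lra.
have t1C : 1 - (u' - u) / L < 1 by lra.
have := f_conv u (u' + h) _ neq t0 t1.
have := f_conv u (u' + h) (1 - (u' - u) / L) neq ltac:(lra) t1C.
have -> : (u' - u) / L * u + (1 - (u' - u) / L) * (u' + h) = u + h.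
  by rewrite /L; field; lra.
have -> : (1 - (u' - u) / L) * u + (1 - (1 - (u' - u) / L)) * (u' + h) = u'.
  by rewrite /L; field; lra.
lra.
Qed.

(** The prices are partial sums making the reduced costs of [i] and [i.+1] tie at [b i.+1].
    Increasing differences make [i] cheaper before the tie and [i.+1] cheaper after it; chaining
    neighbours compares any two indices. *)
Lemma separating_potentials (R : realType) (n : nat) (c : nat -> R -> R)
    (b : nat -> R) :
  {homo b : i j / (i <= j)%N >-> i <= j} ->
  (forall i s t, (i < n)%N -> s < t ->
    c i s - c i.+1 s < c i t - c i.+1 t) ->
  exists v : nat -> R, forall i j s, (i <= n)%N -> (j <= n)%N -> i != j ->
    b j < s < b j.+1 -> c j s - v j < c i s - v i.
Proof.
move=> b_homo c_inc.
pose v i := - \sum_(l < i) (c l (b l.+1) - c l.+1 (b l.+1)).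
have vS i : v i - v i.+1 = c i (b i.+1) - c i.+1 (b i.+1).
  by rewrite /v big_ord_recr /=; lra.
exists v => i j s iN jN ij /andP[bjs sbj].
have [ji|ij'|eij] := ltngtP j i; last by rewrite eij eqxx in ij.
- elim: i ji iN {ij} => // i IHi; rewrite ltnS => ji iN.
  have step : c i s - v i < c i.+1 s - v i.+1.
    have /(c_inc _ _ _ iN) : s < b i.+1 by rewrite (lt_le_trans sbj)// b_homo.
    have := vS i; lra.
  move: ji; rewrite leq_eqVlt => /predU1P[-> //|ji].
  exact: lt_trans (IHi ji (ltnW iN)) step.
(* Here [s] lies after every tie between [i] and [j], so the reduced cost falls at each step from
   [i] up to [j]. *)
- suff H m : (i < m <= j)%N -> c m s - v m < c i s - v i.
    by rewrite H ?ij' ?leqnn.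
  elim: m => // m IHm /andP[]; rewrite ltnS => im mj.
  have step : c m.+1 s - v m.+1 < c m s - v m.
    have /(c_inc _ _ _ (leq_trans mj jN)) : b m.+1 < s.
      by rewrite (le_lt_trans _ bjs)// b_homo.
    have := vS m; lra.
  move: im; rewrite leq_eqVlt => /predU1P[-> //|im].
  by apply: lt_trans step (IHm _); rewrite im ltnW.
Qed.

(** * Breakpoints and the sorted flow *)

(** The time at which the first [n] groups have just been served at capacity. The index is a natural
    number so that both ends, [0] and [K], are covered. *)
Definition breakpoint (R : realType) (K : nat) (mu : R) (Q : 'I_K -> R)
    (s0 : R) (n : nat) : R :=
  s0 + (\sum_(k < K | (k < n)%N) Q k) / mu.

Lemma breakpoint0 (R : realType) (K : nat) (mu : R) (Q : 'I_K -> R) (s0 : R) :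
  breakpoint mu Q s0 0 = s0.
Proof. by rewrite /breakpoint big_pred0// mul0r addr0. Qed.

Lemma breakpointK (R : realType) (K : nat) (mu : R) (Q : 'I_K -> R) (s0 : R) :
  breakpoint mu Q s0 K = s0 + (\sum_(k < K) Q k) / mu.
Proof.
by rewrite /breakpoint (eq_bigl xpredT)// => k; rewrite ltn_ord.
Qed.

Lemma breakpointS (R : realType) (K : nat) (mu : R) (Q : 'I_K -> R) (s0 : R)
    (k : 'I_K) :
  breakpoint mu Q s0 k.+1 = breakpoint mu Q s0 k + Q k / mu.
Proof.
rewrite /breakpoint (bigD1 k)//= -addrA -mulrDl [Q k + _]addrC.
congr (_ + (_ + _) / _).
by apply: eq_bigl => i; rewrite ltnS (ltn_neqAle i) andbC.
Qed.

Lemma breakpoint_homo (R : realType) (K : nat) (mu : R) (Q : 'I_K -> R)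
    (s0 : R) :
  0 < mu -> (forall k, 0 <= Q k) ->
  {homo breakpoint mu Q s0 : i j / (i <= j)%N >-> i <= j}.
Proof.
move=> mu0 Q0 i j ij; rewrite lerD2l ler_pM2r ?invr_gt0//.
rewrite !(big_mkcond (fun k : 'I_K => (k < _)%N)) /=.
apply: ler_sum => k _.
by have [ki|_] := ltnP k i; [rewrite (leq_trans ki ij)|case: ifP].
Qed.

(** Half-open intervals keep the service periods disjoint; the flow vanishes at the final instant, a
    null set. *)
Definition sorted_flow (R : realType) (K : nat) (mu : R) (Q : 'I_K -> R)
    (s0 : R) (k : 'I_K) (s : R) : R :=
  mu * \1_(`[breakpoint mu Q s0 k, breakpoint mu Q s0 k.+1[%classic) s.

Lemma breakpoint_cover (R : realType) (b : nat -> R) (n : nat) (s : R) :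
  b 0%N <= s < b n -> exists j : 'I_n, b j <= s < b j.+1.
Proof.
elim: n => [|n IHn] /andP[b0s sbn].
  by have := le_lt_trans b0s sbn; rewrite ltxx.
have [bns|sbn'] := leP (b n) s.
  by exists ord_max; rewrite /= bns.
have [|j Hj] := IHn; first by rewrite b0s.
by exists (widen_ord (leqnSn n) j).
Qed.

Lemma sorted_flowE (R : realType) (K : nat) (mu : R) (Q : 'I_K -> R)
    (s0 : R) (k j : 'I_K) (s : R) :
  0 < mu -> (forall k, 0 <= Q k) ->
  breakpoint mu Q s0 j <= s < breakpoint mu Q s0 j.+1 ->
  sorted_flow mu Q s0 k s = mu *+ (k == j).
Proof.
move=> mu0 Q0 /andP[bjs sbj]; rewrite /sorted_flow indicE mem_setE /= in_itv /=.
rewrite mulr_natr; congr (_ *+ _).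
have bh := breakpoint_homo s0 mu0 Q0.
case: (ltngtP k j) => [kj|jk|/val_inj ->]; last by rewrite bjs sbj eqxx.
- have bks : breakpoint mu Q s0 k.+1 <= s by rewrite (le_trans _ bjs)// bh.
  by rewrite -val_eqE (ltn_eqF kj) [s < _]ltNge bks andbF.
- have sbk : s < breakpoint mu Q s0 k by rewrite (lt_le_trans sbj)// bh.
  by rewrite -val_eqE (gtn_eqF jk) leNgt sbk.
Qed.

(** Clamping both endpoints at [s] treats periods before, around and after [s] alike, and the
    differences telescope over [k]. *)
Lemma integral_sorted_flow (R : realType) (K : nat) (mu : R) (Q : 'I_K -> R)
    (s0 : R) (k : 'I_K) (s : R) :
  0 < mu -> (forall k, 0 <= Q k) ->
  (\int[lebesgue_measure]_(t in `[s0, s]) (sorted_flow mu Q s0 k t)%:E)%E =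
  (mu * (Num.min (breakpoint mu Q s0 k.+1) s
         - Num.min (breakpoint mu Q s0 k) s))%:E.
Proof.
move=> mu0 Q0.
under eq_integral do rewrite /sorted_flow EFinM.
rewrite ge0_integralZl_EFin//; last 2 first.
- by apply/measurable_EFinP; exact: measurable_indic.
- exact: ltW.
rewrite integral_indic// EFinM; congr (_ * _)%E.
have bh := breakpoint_homo s0 mu0 Q0.
have b0 : s0 <= breakpoint mu Q s0 k.
  by rewrite -[leLHS](breakpoint0 mu Q); exact: bh.
have : breakpoint mu Q s0 k <= breakpoint mu Q s0 k.+1 by exact: bh.
move: b0; set a := breakpoint _ _ _ k; set b := breakpoint _ _ _ k.+1 => b0 ab.
have [sb|bs] := ltP s b.
  rewrite (_ : _ `&` _ = `[a, s]%classic).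
    rewrite /= lebesgue_measure_itv/= lte_fin.
    by case: (leP a s); case: (ltP a s) => *; rewrite ?subrr//; congr EFin; lra.
  apply/seteqP; split => t /=; rewrite !in_itv/=; lra.
rewrite (_ : _ `&` _ = `[a, b[%classic).
  rewrite /= lebesgue_measure_itv/= lte_fin (min_idPl (le_trans ab bs)).
  by case: (ltP a b) => *; rewrite -?EFinB; congr EFin; lra.
apply/seteqP; split => t /=; rewrite !in_itv/=; lra.
Qed.

(** * Complementary slackness, pointwise and then integrated *)

(** Since [y - x] sums to zero, [w k] may be replaced by [w k - w j]. Every term is then
    nonnegative, and a zero sum forces [y] to vanish off [j]; equal totals settle [j] itself. *)
Lemma pointwise_slackness (R : realDomainType) (K : nat) (w x y : 'I_K -> R)
    (j : 'I_K) :
  (forall k, 0 <= y k) -> \sum_k y k = \sum_k x k ->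
  (forall k, k != j -> x k = 0) -> (forall k, k != j -> w j < w k) ->
  0 <= \sum_k w k * (y k - x k) /\
  (\sum_k w k * (y k - x k) = 0 -> forall k, y k = x k).
Proof.
move=> y0 yx x0 wj.
have d0 : \sum_k (y k - x k) = 0 by rewrite sumrB yx subrr.
have -> : \sum_k w k * (y k - x k) = \sum_k (w k - w j) * (y k - x k).
  under [RHS]eq_bigr do rewrite mulrBl.
  by rewrite [RHS]sumrB -mulr_sumr d0 mulr0 subr0.
have term0 k : true -> 0 <= (w k - w j) * (y k - x k).
  have [->|kj] := eqVneq k j; first by rewrite subrr mul0r.
  by rewrite x0// subr0 mulr_ge0// subr_ge0 ltW// wj.
split; first by rewrite sumr_ge0.
move=> /(psumr_eq0P term0) D0.
have yx_off k : k != j -> y k = x k.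
  move=> kj; have /eqP := D0 k isT.
  by rewrite mulf_eq0 !subr_eq0 gt_eqF ?wj//= => /eqP.
move=> k; have [->|] := eqVneq k j; last exact: yx_off.
move/eqP: d0; rewrite (bigD1 j)//= big1 ?addr0 => [|i ij].
  by rewrite subr_eq0 => /eqP.
by rewrite yx_off ?subrr.
Qed.

(* Here and below [S] is a set of [measurableTypeR R]: the measurable structure
   inferred for [R] has a display that does not unify with the one of
   [lebesgue_measure]. *)
Lemma feasible_integrable (R : realType) (K : nat) (mu : R) (Q : 'I_K -> R)
    (S : set (measurableTypeR R)) (x : 'I_K -> R -> R) (k : 'I_K) :
  measurable S -> feasible mu Q S x ->
  lebesgue_measure.-integrable S (EFin \o x k).
Proof.
move=> mS [mx x0 _ xQ].
have mxE : measurable_fun S (EFin \o x k).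
  by apply/measurable_EFinP; exact: mx.
apply/integrableP; split => //.
suff -> : (\int[lebesgue_measure]_(s in S) `|(EFin \o x k) s| = (Q k)%:E)%E.
  by rewrite ltry.
rewrite -(xQ k).
apply: ae_eq_integral => //; first exact: measurableT_comp.
have aeF := ae_filter_ringOfSetsType (@lebesgue_measure R).
move: (x0 k); apply: (filterS (F:=almost_everywhere _)) => s /[apply] xs0.
by rewrite /= ger0_norm.
Qed.

Lemma cost_integrable (R : realType) (K : nat) (c : 'I_K -> R -> R)
    (mu : R) (Q : 'I_K -> R) (S : set (measurableTypeR R))
    (x : 'I_K -> R -> R) (k : 'I_K) :
  measurable S -> measurable_fun S (c k) -> [bounded c k s | s in S] ->
  feasible mu Q S x ->
  lebesgue_measure.-integrable S (EFin \o (fun s => c k s * x k s)).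
Proof.
move=> mS mc bc fx.
exact: (integrableMr mS mc bc (feasible_integrable k mS fx)).
Qed.

(** The mass constraints turn the price terms into a constant common to all feasible flows, so costs
    can be compared through reduced costs. *)
Lemma integral_reduced_cost (R : realType) (K : nat) (c : 'I_K -> R -> R)
    (mu : R) (Q v : 'I_K -> R) (S : set (measurableTypeR R))
    (x : 'I_K -> R -> R) :
  measurable S -> (forall k, measurable_fun S (c k)) ->
  (forall k, [bounded c k s | s in S]) -> feasible mu Q S x ->
  lebesgue_measure.-integrable S
    (EFin \o (fun s => \sum_k (c k s - v k) * x k s)) /\
  total_cost c S x =
    (\int[lebesgue_measure]_(s in S) (\sum_k (c k s - v k) * x k s)%:E +
     (\sum_k v k * Q k)%:E)%E.
Proof.
move=> mS mc bc fx.
have icx k := cost_integrable mS (mc k) (bc k) fx.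
have ix k := feasible_integrable k mS fx.
have ivx k := integrableZl mS (v k) (ix k).
have iw k : lebesgue_measure.-integrable S
    (EFin \o (fun s => (c k s - v k) * x k s)).
  apply: eq_integrable (integrableB mS (icx k) (ivx k)) => // s _ /=.
  by rewrite mulrBl.
have wE : (EFin \o (fun s => \sum_k (c k s - v k) * x k s)) =
    (fun s => \sum_k ((c k s - v k) * x k s)%:E)%E.
  by apply/funext => s /=; rewrite sumEFin.
split; first by rewrite wE; apply: integrable_sum => // k _; exact: iw.
have := congr1 (fun g => \int[lebesgue_measure]_(s in S) g s)%E wE.
rewrite /= => ->; rewrite integral_sum//.
rewrite /total_cost -sumEFin -big_split /=; apply: eq_bigr => k _.
have [_ _ _ xQ] := fx.
rewrite EFinM -xQ -integralZl//; last exact: ix.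
rewrite -(integralD mS (iw k) (ivx k)).
by apply: eq_integral => s _; rewrite /= -EFinM -EFinD; congr EFin; ring.
Qed.

Lemma complementary_slackness (R : realType) (K : nat) (c : 'I_K -> R -> R)
    (mu : R) (Q v : 'I_K -> R) (S : set (measurableTypeR R))
    (x : 'I_K -> R -> R) :
  measurable S -> (forall k, measurable_fun S (c k)) ->
  (forall k, [bounded c k s | s in S]) -> feasible mu Q S x ->
  {ae lebesgue_measure, forall s, S s -> exists j : 'I_K, forall k, k != j ->
    x k s = 0 /\ c j s - v j < c k s - v k} ->
  optimal c mu Q S x /\ forall y, optimal c mu Q S y -> flow_eq S y x.
Proof.
move=> mS mc bc fx slack.
pose w (y : 'I_K -> R -> R) s := \sum_k (c k s - v k) * y k s.
pose D y s := w y s - w x s.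
have Dslack y : feasible mu Q S y ->
    {ae lebesgue_measure, forall s, S s ->
      0 <= D y s /\ (D y s = 0 -> forall k, y k s = x k s)}.
  move=> [_ y0 ys _]; have [_ _ xs _] := fx.
  have aeF := ae_filter_ringOfSetsType (@lebesgue_measure R).
  have yge0 := filter_forall aeF y0.
  have xys := filterS2 aeF (fun s xs ys => conj xs ys) xs ys.
  apply: filterS3 slack xys yge0 => s slacks [xs' ys'] ys0 Ss.
  have [j jP] := slacks Ss.
  have -> : D y s = \sum_k (c k s - v k) * (y k s - x k s).
    by rewrite /D /w -sumrB; apply: eq_bigr => k _; rewrite mulrBr.
  apply: (@pointwise_slackness _ _ _ _ _ j).
  - by move=> k; exact: ys0.
  - by rewrite xs' ?ys'.
  - by move=> k /jP[].
  - by move=> k /jP[].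
have [iwx wxE] := integral_reduced_cost v mS mc bc fx.
have wxfin : (\int[lebesgue_measure]_(s in S) (w x s)%:E)%E \is a fin_num.
  exact: integrable_fin_num.
(* Finiteness is what allows cancellation in the extended reals below. *)
have xfin : total_cost c S x \is a fin_num by rewrite wxE fin_numD wxfin.
(* As [D y] is nonnegative almost everywhere, the excess cost of [y] is its L1 norm: this gives
   optimality of [x], and uniqueness when the norm is zero. *)
have DE y : feasible mu Q S y ->
    total_cost c S y = (total_cost c S x +
      \int[lebesgue_measure]_(s in S) `|(D y s)%:E|)%E /\
    ((\int[lebesgue_measure]_(s in S) `|(D y s)%:E|)%E = 0%E ->
      flow_eq S y x).
  move=> fy; have [iwy wyE] := integral_reduced_cost v mS mc bc fy.
  have iD : lebesgue_measure.-integrable S (EFin \o D y).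
    by have := integrableB mS iwy iwx.
  have mD := measurable_int _ iD.
  have DD := Dslack y fy; split.
    have absD : ae_eq lebesgue_measure S (EFin \o D y)
        (fun s => `|(EFin \o D y) s|%E).
      apply: filterS DD => s DD /DD[Ds0 _].
      by rewrite /= ger0_norm.
    rewrite -(ae_eq_integral _ _ mS mD _ absD); last exact: measurableT_comp.
    have -> : (\int[lebesgue_measure]_(s in S) (EFin \o D y) s =
        \int[lebesgue_measure]_(s in S) (w y s)%:E -
        \int[lebesgue_measure]_(s in S) (w x s)%:E)%E.
      exact: (integralB mS iwy iwx).
    rewrite wyE wxE [RHS]addeAC; congr (_ + _)%E.
    by rewrite addeC subeK.
  move=> D0 k; have /(ae_eq_integral_abs _ mS mD) := D0.
  have aeF := ae_filter_ringOfSetsType (@lebesgue_measure R).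
  apply: filterS2 DD => s DD D0s Ss.
  have [_ ->//] := DD Ss.
  by have [] := D0s Ss.
split.
  split=> // y /DE[-> _].
  by apply: leeDl; exact: integral_ge0.
move=> y [fy ymin]; have [yE] := DE y fy; apply.
apply/eqP; rewrite eq_le integral_ge0// andbT.
by have := ymin _ fx; rewrite yE -leeBrDl// subee.
Qed.

(** * Feasibility and cumulative form of the sorted flow *)

(** The breakpoints form a countable, hence null, set. Strictness on both sides is what the
    separating prices require. *)
Lemma ae_between_breakpoints (R : realType) (K : nat) (mu : R)
    (Q : 'I_K -> R) (s0 : R) :
  {ae lebesgue_measure, forall s, rush_period mu Q s0 s ->
    exists j : 'I_K,
      breakpoint mu Q s0 j < s < breakpoint mu Q s0 j.+1}.
Proof.
have cb : countable (range (breakpoint mu Q s0)).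
  by apply: sub_countable (card_image_le _ _) _.
exists (range (breakpoint mu Q s0)); split.
- exact: countable_measurable.
- exact: countable_lebesgue_measure0.
move=> s /= ns; apply: contrapT => nb; apply: ns.
rewrite /rush_period -breakpointK /= in_itv /= => /andP[s0s sb].
have neq i : breakpoint mu Q s0 i != s by apply/eqP => bs; apply: nb; exists i.
have [|j /andP[bjs sbj]] := @breakpoint_cover _ (breakpoint mu Q s0) K s.
  by rewrite breakpoint0 s0s lt_neqAle eq_sym neq.
by exists j; rewrite sbj lt_neqAle neq bjs.
Qed.

Lemma sorted_flow_feasible (R : realType) (K : nat) (mu : R) (Q : 'I_K -> R)
    (s0 : R) :
  0 < mu -> (forall k, 0 <= Q k) ->
  feasible mu Q (rush_period mu Q s0) (sorted_flow mu Q s0).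
Proof.
move=> mu0 Q0; split.
- move=> k; apply: measurable_funM => //; exact: measurable_indic.
- by move=> k; apply: aeW => s _; rewrite mulr_ge0// ltW.
- have aeF := ae_filter_ringOfSetsType (@lebesgue_measure R).
  apply: filterS (ae_between_breakpoints mu Q s0) => s jP /jP[j /andP[bjs sbj]].
  have itv : breakpoint mu Q s0 j <= s < breakpoint mu Q s0 j.+1.
    by rewrite sbj ltW.
  rewrite (bigD1 j)//= (sorted_flowE _ mu0 Q0 itv) eqxx big1 ?addr0// => k kj.
  by rewrite (sorted_flowE _ mu0 Q0 itv) (negbTE kj).
- move=> k; rewrite /rush_period -breakpointK integral_sorted_flow//.
  have bh := breakpoint_homo s0 mu0 Q0.
  rewrite !min_l; [|by apply: bh; rewrite ltnW|exact: bh].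
  by rewrite breakpointS addrC addKr mulrC divfK// gt_eqF.
Qed.

Lemma cumulative_sorted_flow (R : realType) (K : nat) (mu : R) (Q : 'I_K -> R)
    (s0 kappa s : R) :
  0 < mu -> (forall k, 0 <= Q k) -> 0 <= kappa <= K%:R -> s0 <= s ->
  cumulative_flow s0 (sorted_flow mu Q s0) kappa s =
  (Num.min (cumulative_mass Q kappa) (mu * (s - s0)))%:E.
Proof.
move=> mu0 Q0 /andP[kappa0 kappaK] s0s.
(* The groups numbered up to [kappa] are the ordinals below [m], so their integrals telescope from
   [s0] to the breakpoint [m], clamped at [s]. *)
pose m := Num.trunc kappa.
have mK : (m <= K)%N.
  by rewrite -(ler_nat R) (le_trans _ kappaK)// truncn_le.
rewrite /cumulative_flow /cumulative_mass.
have mE (k : 'I_K) : (k.+1%:R <= kappa) = (k < m)%N by rewrite truncn_gt_nat.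
rewrite !(eq_bigl _ _ mE) {mE}.
under eq_bigr do rewrite integral_sorted_flow//.
rewrite sumEFin -mulr_sumr.
rewrite -(big_ord_widen K (fun i => Num.min (breakpoint mu Q s0 i.+1) s -
  Num.min (breakpoint mu Q s0 i) s) mK).
rewrite -(big_mkord xpredT (fun i => Num.min (breakpoint mu Q s0 i.+1) s -
  Num.min (breakpoint mu Q s0 i) s)) telescope_sumr//.
rewrite breakpoint0 (min_l s0s) /breakpoint -/m.
set M := \sum_(k < K | _) _; congr EFin.
have [Ms|Ms] := leP M (mu * (s - s0)).
  rewrite min_l; last by rewrite -lerBrDl ler_pdivrMr// mulrC.
  by rewrite addrC addKr mulrC divfK// gt_eqF.
by rewrite min_r// -lerBlDl ler_pdivlMr// mulrC ltW.
Qed.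

Theorem proposition5p1 (R : realType) (K : nat) (hK : (0 < K)%N)
    (sigma : 'I_K -> R)
    (hsigma : forall i j : 'I_K, (i < j)%N -> sigma i < sigma j)
    (f : R -> R) (f_cont : continuous f) (f_conv : strictly_convex f)
    (f_min : forall t : R, f 0 <= f t)
    (mu : R) (hmu : 0 < mu)
    (Q : 'I_K -> R) (hQ : forall k, 0 < Q k) (s0 : R) :
  exists x : 'I_K -> R -> R,
    [/\ optimal (schedule_cost f sigma) mu Q (rush_period mu Q s0) x,
        forall y : 'I_K -> R -> R,
          optimal (schedule_cost f sigma) mu Q (rush_period mu Q s0) y ->
          flow_eq (rush_period mu Q s0) y x &
        forall kappa s : R, 1 <= kappa <= K%:R -> rush_period mu Q s0 s ->
          cumulative_flow s0 x kappa s =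
          (Num.min (cumulative_mass Q kappa) (mu * (s - s0)))%:E].
Proof.
have Q0 k : 0 <= Q k by rewrite ltW.
exists (sorted_flow mu Q s0).
have [v vP] : exists v : 'I_K -> R, forall (k j : 'I_K) s, k != j ->
    breakpoint mu Q s0 j < s < breakpoint mu Q s0 j.+1 ->
    schedule_cost f sigma j s - v j < schedule_cost f sigma k s - v k.
  (* Writing [K] as [n.+1] makes [inord] available, which extends the costs to natural indices. *)
  case: K hK sigma hsigma Q hQ Q0 => // n _ sigma hsigma Q _ Q0.
  have [|v vP] := @separating_potentials R n
    (fun i => schedule_cost f sigma (inord i)) _ (breakpoint_homo s0 hmu Q0).
    move=> i s t iN st; rewrite /schedule_cost.
    have sii : sigma (inord i) < sigma (inord i.+1).
      by apply: hsigma; rewrite !inordK ?ltnS// ltnW.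
    (* The increment is the gap between consecutive preferred times, so adding it to
       [s - sigma (inord i.+1)] yields [s - sigma (inord i)]. *)
    have := @strictly_convex_increment _ f (s - sigma (inord i.+1))
      (t - sigma (inord i.+1)) (sigma (inord i.+1) - sigma (inord i)) f_conv.
    rewrite !addrA !subrK; apply; lra.
  exists v => k j s kj bs.
  have := vP k j s (ltn_ord k) (ltn_ord j) kj bs.
  by rewrite !inord_val.
have c_cont k : continuous (schedule_cost f sigma k).
  move=> s; apply: continuous_comp; last exact: f_cont.
  by apply: cvgB => //; exact: cvg_cst.
have [|||||opt uniq] := @complementary_slackness R K (schedule_cost f sigma) mu
    Q v (rush_period mu Q s0) (sorted_flow mu Q s0).
- exact: measurable_itv.
- move=> k.
  exact: measurable_funS (continuous_measurable_fun (c_cont k)).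
(* A continuous cost is bounded on the compact rush period. *)
- move=> k; have /compact_bounded[M [Mreal MP]] : compact
      (schedule_cost f sigma k @` rush_period mu Q s0).
    apply: continuous_compact; last exact: segment_compact.
    by apply: continuous_subspaceT; exact: c_cont.
  by exists M; split=> // N MN s Ss; apply: MP => //; exists s.
- exact: sorted_flow_feasible.
- have aeF := ae_filter_ringOfSetsType (@lebesgue_measure R).
  apply: filterS (ae_between_breakpoints mu Q s0) => s jP /jP[j bs].
  exists j => k kj; split; last exact: vP.
  have /andP[bjs sbj] := bs.
  by rewrite (@sorted_flowE _ _ _ _ _ _ j)// ?(ltW bjs)// (negbTE kj).
split=> // kappa s /andP[kappa1 kappaK].
rewrite /rush_period /= in_itv /= => /andP[s0s _].
apply: cumulative_sorted_flow => //.
by rewrite kappaK (le_trans _ kappa1).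
Qed.
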